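(* Let $\mathcal A_s=\mathbb{C}[x,y][[s]]$, $t=xy$, $h_{s,t}=1+\sum_{i\geq 1}s^it^i\in\mathcal A_s$, $E=x\partial_x+y\partial_y$ and $R=y\partial_y-x\partial_x$. Let $$D_0^\bullet:\ 0\to\mathcal A_s\xrightarrow{\epsilon_0^1}\mathcal A_s^2\xrightarrow{\epsilon_0^2}\mathcal A_s\to 0,\qquad \epsilon_0^1(f)=(Ef,Rf),\quad \epsilon_0^2(a,b)=Eb-Ra,$$ $$D_s^\bullet:\ 0\to\mathcal A_s\xrightarrow{\epsilon_s^1}\mathcal A_s^2\xrightarrow{\epsilon_s^2}\mathcal A_s\to 0,\qquad \epsilon_s^1(f)=(h_{s,t}Ef,Rf),\quad \epsilon_s^2(a,b)=h_{s,t}Eb-Ra$$ be the logarithmic de Rham complexes of $D_0=\{t=0\}$ and $D_s=\{t\,h_{s,t}=0\}$, respectively, written in the corresponding dual Saito bases. Then $\Psi^0=\operatorname{Id}$, $\Psi^1(a,b)=(h_{s,t}a,b)$, $\Psi^2(c)=h_{s,t}c$ defines an isomorphism of cochain complexes $D_0^\bullet\simeq D_s^\bullet$.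
   Context: The derivations $E$ and $R$ of $\mathbb{C}[x,y]$ are extended $s$-coefficientwise (i.e. $\mathbb{C}[[s]]$-linearly) to $\mathcal A_s$. The divisor $D_s$ is the formal polynomial deformation $\varphi_s=t+\sum_{i\geq1}s^it^{i+1}=t\,h_{s,t}$ of the normal crossing divisor $D_0$; the complexes above are written in terms of the logarithmic vector fields $E,R$ for $D_0$ and $h_{s,t}E,R$ for $D_s$. *)

(* Defs.v *)
From HB Require Import structures.
From mathcomp Require Import all_boot all_order all_algebra.
From mathcomp Require Import mpoly complex.
From mathcomp Require Import boolp reals.

Set Implicit Arguments.
Unset Strict Implicit.
Unset Printing Implicit Defensive.

Import GRing.Theory.

Local Open Scope ring_scope.

(* Formal power series [V[[s]]]: [coefs u n] is the coefficient of [s^n]. *)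
Record fps (V : Type) := FPS { coefs :> nat -> V }.

Notation "{ 'fps' V }" := (fps V) (format "{ 'fps'  V }") : type_scope.

Lemma fpsP (V : Type) (u v : {fps V}) : u =1 v -> u = v.
Proof. by case: u v => [u] [v] /= uv; congr FPS; apply/funext. Qed.

HB.instance Definition _ (V : Type) := gen_eqMixin {fps V}.
HB.instance Definition _ (V : Type) := gen_choiceMixin {fps V}.

Definition fps_map (V W : Type) (f : V -> W) (u : {fps V}) : {fps W} :=
  FPS (fun n => f (u n)).

Section FpsZmod.
Variable V : zmodType.

Definition fps_zero : {fps V} := FPS (fun=> 0).
Definition fps_opp (u : {fps V}) : {fps V} := FPS (fun n => - u n).
Definition fps_add (u v : {fps V}) : {fps V} := FPS (fun n => u n + v n).

Lemma fps_addA : associative fps_add.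
Proof. by move=> u v w; apply: fpsP => n /=; rewrite addrA. Qed.
Lemma fps_addC : commutative fps_add.
Proof. by move=> u v; apply: fpsP => n /=; rewrite addrC. Qed.
Lemma fps_add0 : left_id fps_zero fps_add.
Proof. by move=> u; apply: fpsP => n /=; rewrite add0r. Qed.
Lemma fps_addN : left_inverse fps_zero fps_opp fps_add.
Proof. by move=> u; apply: fpsP => n /=; rewrite addNr. Qed.

HB.instance Definition _ := GRing.isZmodule.Build {fps V}
  fps_addA fps_addC fps_add0 fps_addN.

Definition fps_const (v : V) : {fps V} :=
  FPS (fun n => if n is 0%N then v else 0).

Lemma sum_triangle (n : nat) (F : nat -> nat -> nat -> V) :
  \sum_(i < n.+1) \sum_(j < (n - i).+1) F i j (n - i - j)%N =
  \sum_(k < n.+1) \sum_(i < k.+1) F i (k - i)%N (n - k)%N.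
Proof.
pose G i k := F i (k - i)%N (n - k)%N.
transitivity (\sum_(0 <= i < n.+1) \sum_(i <= k < n.+1) G i k).
  rewrite big_mkord; apply: eq_bigr => i _.
  have := big_addn 0 n.+1 i xpredT (G i); rewrite add0n => ->.
  rewrite (subSn (leq_ord i)) big_mkord.
  by apply: eq_bigr => j _; rewrite /G addnK addnC subnDA.
transitivity (\sum_(0 <= k < n.+1) \sum_(0 <= i < k.+1) G i k); last first.
  by rewrite big_mkord; apply: eq_bigr => k _; rewrite big_mkord.
transitivity (\sum_(0 <= i < n.+1) \sum_(0 <= k < n.+1 | (i <= k)%N) G i k).
  by apply: eq_bigr => i _; rewrite (big_nat_widenl i 0).
rewrite (exchange_big_dep_nat xpredT) //= big_nat [RHS]big_nat.
apply: eq_bigr => k /andP[_ kn].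
by rewrite (big_nat_widen 0 k.+1 n.+1).
Qed.

End FpsZmod.

Section FpsRing.
Variable K : comNzRingType.

Definition fps_mul (u v : {fps K}) : {fps K} :=
  FPS (fun n => \sum_(i < n.+1) u i * v (n - i)%N).

Lemma fps_mulA : associative fps_mul.
Proof.
move=> u v w; apply: fpsP => n /=.
transitivity (\sum_(i < n.+1) \sum_(j < (n - i).+1)
    u i * v j * w (n - i - j)%N).
  apply: eq_bigr => i _; rewrite mulr_sumr.
  by apply: eq_bigr => j _; rewrite mulrA.
rewrite (sum_triangle n (fun i j k => u i * v j * w k)).
by apply: eq_bigr => i _; rewrite mulr_suml.
Qed.

Lemma fps_mulC : commutative fps_mul.
Proof.
move=> u v; apply: fpsP => n /=.
rewrite (reindex_inj rev_ord_inj) /=; apply: eq_bigr => i _.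
by rewrite subSS subKn ?leq_ord // mulrC.
Qed.

Lemma fps_mul1 : left_id (fps_const 1) fps_mul.
Proof.
move=> u; apply: fpsP => n /=.
by rewrite big_ord_recl /= mul1r subn0 big1 ?addr0 // => i _; rewrite mul0r.
Qed.

Lemma fps_mulDl : left_distributive fps_mul +%R.
Proof.
move=> u v w; apply: fpsP => n /=; rewrite -big_split /=.
by apply: eq_bigr => i _; rewrite mulrDl.
Qed.

Lemma fps_1_neq0 : fps_const (1 : K) != 0.
Proof. by apply/eqP => /(congr1 (fun u : {fps K} => u 0%N))/eqP; rewrite oner_eq0. Qed.

HB.instance Definition _ := GRing.Zmodule_isComNzRing.Build {fps K}
  fps_mulA fps_mulC fps_mul1 fps_mulDl fps_1_neq0.

(* [V[[s]]] as a module over [K[[s]]]. *)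
Variable V : lmodType K.

Definition fps_scale (a : {fps K}) (u : {fps V}) : {fps V} :=
  FPS (fun n => \sum_(i < n.+1) a i *: u (n - i)%N).

Lemma fps_scaleA a b u : fps_scale a (fps_scale b u) = fps_scale (a * b) u.
Proof.
apply: fpsP => n /=.
transitivity (\sum_(i < n.+1) \sum_(j < (n - i).+1)
    (a i * b j) *: u (n - i - j)%N).
  apply: eq_bigr => i _; rewrite scaler_sumr.
  by apply: eq_bigr => j _; rewrite scalerA.
rewrite (sum_triangle n (fun i j k => (a i * b j) *: u k)).
by apply: eq_bigr => i _; rewrite scaler_suml.
Qed.

Lemma fps_scale1 : left_id 1 fps_scale.
Proof.
move=> u; apply: fpsP => n /=; rewrite big_ord_recl /= scale1r subn0.
by rewrite big1 ?addr0 // => i _; rewrite scale0r.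
Qed.

Lemma fps_scaleDr : right_distributive fps_scale +%R.
Proof.
move=> a u v; apply: fpsP => n /=; rewrite -big_split /=.
by apply: eq_bigr => i _; rewrite scalerDr.
Qed.

Lemma fps_scaleDl u : {morph fps_scale^~ u : a b / a + b}.
Proof.
move=> a b; apply: fpsP => n /=; rewrite -big_split /=.
by apply: eq_bigr => i _; rewrite scalerDl.
Qed.

HB.instance Definition _ := GRing.Zmodule_isLmodule.Build {fps K} {fps V}
  fps_scaleA fps_scale1 fps_scaleDr fps_scaleDl.

End FpsRing.

Section CochainComplexes.
Variable S : nzRingType.

(* [0 -> C0 -> C1 -> C2 -> 0] is a cochain complex of [S]-modules. *)
Definition is_complex (C0 C1 C2 : lmodType S)
    (d0 : C0 -> C1) (d1 : C1 -> C2) : Prop :=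
  [/\ linear d0, linear d1 & forall f, d1 (d0 f) = 0].

Definition cochain_map (C0 C1 C2 D0 D1 D2 : lmodType S)
    (c0 : C0 -> C1) (c1 : C1 -> C2) (d0 : D0 -> D1) (d1 : D1 -> D2)
    (psi0 : C0 -> D0) (psi1 : C1 -> D1) (psi2 : C2 -> D2) : Prop :=
  [/\ linear psi0, linear psi1, linear psi2,
      forall f, psi1 (c0 f) = d0 (psi0 f) &
      forall w, psi2 (c1 w) = d1 (psi1 w)].

Definition cochain_iso (C0 C1 C2 D0 D1 D2 : lmodType S)
    (c0 : C0 -> C1) (c1 : C1 -> C2) (d0 : D0 -> D1) (d1 : D1 -> D2)
    (psi0 : C0 -> D0) (psi1 : C1 -> D1) (psi2 : C2 -> D2) : Prop :=
  cochain_map c0 c1 d0 d1 psi0 psi1 psi2 /\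
  [/\ bijective psi0, bijective psi1 & bijective psi2].

End CochainComplexes.


Notation Cxy R := {mpoly R[i][2]}.
Notation As R := {fps Cxy R}.
Notation Cs R := {fps R[i]}.

(* The logarithmic de Rham complex of the divisor [g = 0], relative to
   [C[[s]]]: logarithmic p-forms are the alternating [As]-multilinear maps on
   the module [Der(-log g)], with the Cartan differential. *)
Section LogDeRham.
Variable R : realType.
Implicit Types (f g : As R) (delta : As R -> As R).

Definition derivation delta : Prop :=
  (forall (c : Cs R) (u v : As R), delta (c *: u + v) = c *: delta u + delta v)
  /\ (forall u v : As R, delta (u * v) = delta u * v + u * delta v).

(* [delta] belongs to [Der(-log g)]. *)
Definition log_der g delta : Prop :=
  derivation delta /\ exists r : As R, delta g = r * g.

(* [Der(-log g)] is a free [As]-module with basis [delta1, delta2]. *)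
Definition saito_basis g delta1 delta2 : Prop :=
  [/\ log_der g delta1, log_der g delta2 &
      forall delta, log_der g delta ->
        exists! ab : As R * As R,
          forall f, delta f = ab.1 * delta1 f + ab.2 * delta2 f].

Definition der_bracket delta delta' : As R -> As R :=
  fun f => delta (delta' f) - delta' (delta f).

(* A 1-form [w] is only meaningful on [Der(-log g)]; its values elsewhere are
   junk. *)
Definition log_form1 g (w : (As R -> As R) -> As R) : Prop :=
  forall (a : As R) delta delta', log_der g delta -> log_der g delta' ->
    w (fun f => a * delta f + delta' f) = a * w delta + w delta'.

Definition log_d0 f delta : As R := delta f.

Definition log_d1 (w : (As R -> As R) -> As R) delta delta' : As R :=
  delta (w delta') - delta' (w delta) - w (der_bracket delta delta').

(* [d0, d1] are the differentials of the logarithmic de Rham complex of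
   [g = 0] in the basis dual to the Saito basis [delta1, delta2]: a 1-form [w]
   has coordinates [(w delta1, w delta2)], and a 2-form has as coordinate its
   value at [(delta1, delta2)]. *)
Definition log_de_Rham_in_basis g delta1 delta2
    (d0 : As R -> As R * As R) (d1 : As R * As R -> As R) : Prop :=
  [/\ saito_basis g delta1 delta2,
      forall f, d0 f = (log_d0 f delta1, log_d0 f delta2) &
      forall w, log_form1 g w ->
        d1 (w delta1, w delta2) = log_d1 w delta1 delta2].

End LogDeRham.

Section Deformation.
Variable R : realType.

Definition xC : Cxy R := 'X_ord0.
Definition yC : Cxy R := 'X_ord_max.

Definition dx (p : Cxy R) : Cxy R := mderiv ord0 p.
Definition dy (p : Cxy R) : Cxy R := mderiv ord_max p.

Definition derE : As R -> As R := fps_map (fun p => xC * dx p + yC * dy p).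
Definition derR : As R -> As R := fps_map (fun p => yC * dy p - xC * dx p).

Definition tC : Cxy R := xC * yC.
Definition t_s : As R := fps_const tC.

(* [1 + \sum_(i >= 1) s^i t^i]; the coefficient of [s^0] is [tC ^+ 0 = 1]. *)
Definition h_s : As R := FPS (fun i => tC ^+ i).

Definition eps0_1 (f : As R) : As R * As R := (derE f, derR f).
Definition eps0_2 (ab : As R * As R) : As R := derE ab.2 - derR ab.1.

Definition epss_1 (f : As R) : As R * As R := (h_s * derE f, derR f).
Definition epss_2 (ab : As R * As R) : As R := h_s * derE ab.2 - derR ab.1.

Definition Psi0 (f : As R) : As R := f.
Definition Psi1 (ab : As R * As R) : As R * As R := (h_s * ab.1, ab.2).
Definition Psi2 (c : As R) : As R := h_s * c.

End Deformation.

(* Main.v *)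
(* A C[[s]]-linear derivation of C[x,y][[s]] is determined by its values on x
   and y, by induction on the order in s.  If delta preserves (t), then x divides
   delta x and y divides delta y, which gives its unique coordinates in E and R.
   As h = 1 / (1 - s t) is a unit and delta (t h) = h^2 delta t, the divisors t and
   t h have the same logarithmic derivations, so (h E, R) is a Saito basis for
   t h.  Finally R h = 0, so R commutes with multiplication by h, and the maps Psi
   are compatible with the differentials and invertible. *)
Require Import Defs.
From HB Require Import structures.
From mathcomp Require Import all_boot all_order all_algebra.
From mathcomp Require Import mpoly complex.
From mathcomp Require Import boolp reals.
From mathcomp Require Import ring.

Import GRing.Theory.

Local Open Scope ring_scope.

(** * Constants, the variable [s], and divisibility by a variable *)

Section PowerSeries.
Variable K : comNzRingType.
Implicit Types (a b : K) (u v : {fps K}).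

Lemma fps_constME a u n : (fps_const a * u) n = a * u n.
Proof.
by rewrite /= big_ord_recl /= subn0 big1 ?addr0 // => i _; rewrite mul0r.
Qed.

Lemma fps_constM a b : fps_const a * fps_const b = fps_const (a * b).
Proof.
by apply: fpsP => n; rewrite fps_constME; case: n => //= n; rewrite mulr0.
Qed.

Definition fpsX : {fps K} := FPS (fun n => (n == 1%N)%:R).

Lemma fpsX_scaleE (V : lmodType K) (u : {fps V}) n :
  (fpsX *: u) n = if n is m.+1 then u m else 0.
Proof.
case: n => [|n] /=; first by rewrite big_ord1 scale0r.
rewrite !big_ord_recl /= scale0r add0r scale1r subSS subn0.
by rewrite big1 ?addr0 // => i _; rewrite scale0r.
Qed.

(** Splitting off the constant term supports induction on the order in [s]: a linear map lets the
    factor [fpsX] pass through. *)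
Lemma fps_shift (V : lmodType K) (u : {fps V}) :
  u = fpsX *: FPS (fun n => u n.+1) + fps_const (u 0%N).
Proof.
apply: fpsP => n.
change (u n = (fpsX *: FPS (fun n => u n.+1)) n + fps_const (u 0%N) n).
by rewrite fpsX_scaleE; case: n => [|n] /=; rewrite ?add0r ?addr0.
Qed.

End PowerSeries.

(** Turns the scalar action into a ring product, so that [ring] can decide identities mixing
    both. *)
Lemma fps_scaleE (K : comNzRingType) n (c : {fps K}) (u : {fps {mpoly K[n]}}) :
  c *: u = fps_map (@mpolyC n K) c * u.
Proof. by apply: fpsP => k; apply: eq_bigr => i _; rewrite mul_mpolyC. Qed.

(** Every monomial of [q * 'X_j] has a positive exponent at [j], and multiplying by ['X_i] leaves
    that exponent unchanged, so every monomial of [p] contains ['X_j]. *)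
Lemma mpolyX_dvd (K : nzRingType) n (i j : 'I_n) (p q : {mpoly K[n]}) :
  i != j -> p * 'X_i = q * 'X_j -> exists r, p = r * 'X_j.
Proof.
move=> ij pq.
have p0 (m : 'X_{1..n}) : m j = 0%N -> p@_m = 0.
  move=> mj; rewrite -(mcoeffMX p U_(i)) pq.
  apply/memN_msupp_eq0/negP => /msuppM_le; rewrite msuppX.
  case/allpairsP => -[m1 m2] /= [_]; rewrite mem_seq1 => /eqP ->.
  by move/(congr1 (fun m : 'X_{1..n} => m j));
    rewrite !mnmDE !mnm1E eqxx (negPf ij) mj addn1.
(* Subtraction of multi-indices is truncated; where it truncates, [p0] makes the coefficient
   vanish. *)
exists (\sum_(m <- msupp p) p@_m *: 'X_[m - U_(j)]).
rewrite {1}[p]mpolyE mulr_suml; apply: eq_bigr => m _.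
have [mj|mj] := eqVneq (m j) 0%N; first by rewrite p0 // !scale0r mul0r.
rewrite -scalerAl -mpolyXD submK //; apply/mnm_lepP => k; rewrite mnm1E.
by case: eqVneq => // <-; rewrite lt0n.
Qed.

(** * Derivations over [C[[s]]] *)

Section Derivations.
Variable R : realType.
Implicit Types (u v : As R) (delta : As R -> As R).

Definition x_s : As R := fps_const (xC R).
Definition y_s : As R := fps_const (yC R).

Lemma t_sE : t_s R = x_s * y_s.
Proof. by rewrite /x_s /y_s fps_constM. Qed.

Section Basics.
Variable delta : As R -> As R.
Hypothesis dd : derivation delta.

Lemma derM u v : delta (u * v) = delta u * v + u * delta v.
Proof. by case: dd. Qed.

Lemma derD u v : delta (u + v) = delta u + delta v.
Proof. by case: dd => dl _; have := dl 1 u v; rewrite !scale1r. Qed.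

Lemma der0 : delta 0 = 0.
Proof. by apply: (addIr (delta 0)); rewrite -derD !add0r. Qed.

Lemma derN u : delta (- u) = - delta u.
Proof. by apply: (addIr (delta u)); rewrite -derD !addNr der0. Qed.

Lemma derZ c u : delta (c *: u) = c *: delta u.
Proof. by case: dd => dl _; have := dl c u 0; rewrite !addr0 der0 addr0. Qed.

Lemma der1 : delta 1 = 0.
Proof.
by apply: (addrI (delta 1)); rewrite -[in RHS](mulr1 1) derM mulr1 mul1r addr0.
Qed.

End Basics.

Lemma derivation_comb a delta delta' : derivation delta -> derivation delta' ->
  derivation (fun f => a * delta f + delta' f).
Proof.
move=> d d'; split=> [c u v|u v].
  rewrite (derD _ d) (derD _ d') (derZ _ d) (derZ _ d') !fps_scaleE; ring.
by rewrite (derM _ d) (derM _ d'); ring.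
Qed.

Lemma derivation0 : derivation (fun=> 0 : As R).
Proof. by split=> [c u v|u v]; rewrite ?scaler0 ?mul0r ?mulr0 addr0. Qed.

Lemma derivation_scale a delta :
  derivation delta -> derivation (fun f => a * delta f).
Proof.
move=> d; split=> [c u v|u v].
  rewrite (derD _ d) (derZ _ d) !fps_scaleE; ring.
by rewrite (derM _ d); ring.
Qed.

Lemma derivation_bracket delta delta' : derivation delta ->
  derivation delta' -> derivation (der_bracket delta delta').
Proof.
move=> d d'; rewrite /der_bracket; split=> [c u v|u v].
  rewrite !(derD _ d, derD _ d', derZ _ d, derZ _ d') !fps_scaleE; ring.
by rewrite !(derM _ d, derM _ d', derD _ d, derD _ d'); ring.
Qed.

(** The uniqueness principle behind all later identities of derivations. Vanishing spreads from the
    variables to their powers, to monomials, to polynomials, and then to series. *)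
Lemma derivation_eq0 delta : derivation delta ->
  delta x_s = 0 -> delta y_s = 0 -> forall f, delta f = 0.
Proof.
move=> d dx0 dy0.
have dX (i : 'I_2) : delta (fps_const 'X_i) = 0.
  by case: i => [[|[|//]] i2]; [rewrite -[RHS]dx0 | rewrite -[RHS]dy0];
    congr (delta (fps_const 'X_[U_(_)])); apply: val_inj.
have dXn (i : 'I_2) k : delta (fps_const ('X_i ^+ k)) = 0.
  elim: k => [|k IH]; first by rewrite expr0; exact: der1.
  by rewrite exprS -fps_constM (derM _ d) dX IH mul0r mulr0 addr0.
have dm m : delta (fps_const ('X_[m] : Cxy R)) = 0.
  rewrite mpolyXE_id big_ord_recl big_ord1.
  by rewrite -fps_constM (derM _ d) !dXn mul0r mulr0 addr0.
have dc (p : Cxy R) : delta (fps_const p) = 0.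
  elim/mpolyind: p => [|c m p _ _ IH].
    rewrite -[RHS](der0 _ d); congr delta.
    by apply: fpsP => -[].
  have -> : fps_const (c *: 'X_[m] + p) =
      fps_const c *: fps_const ('X_[m] : Cxy R) + fps_const p.
    rewrite fps_scaleE; apply: fpsP => n.
    have -> : fps_map (@mpolyC 2 R[i]) (fps_const c) = fps_const c%:MP.
      by apply: fpsP => -[|k] //=; rewrite mpolyC0.
    change (fps_const (c *: 'X_[m] + p) n =
      (fps_const c%:MP * fps_const ('X_[m] : Cxy R)) n + fps_const p n).
    by rewrite fps_constM mul_mpolyC; case: n => //= n; rewrite addr0.
  by rewrite (derD _ d) (derZ _ d) dm IH scaler0 addr0.
(* Since [delta] kills the constant term, the coefficient at [n.+1] of [delta f] is the one at [n]
   for the shifted series; hence the induction is over all [f]. *)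
move=> f; apply: fpsP => n; elim: n f => [|n IH] f;
  by rewrite (fps_shift _ _ f) (derD _ d) (derZ _ d) dc addr0 fpsX_scaleE ?IH.
Qed.

(** * The fields [E] and [R], and their values on [x], [y] and [t] *)

Lemma derivation_fps_map (d : Cxy R -> Cxy R) :
  linear d -> (forall p q, d (p * q) = d p * q + p * d q) ->
  derivation (fps_map d).
Proof.
move=> dl dM.
have d0 : d 0 = 0.
  by have := dl (-1) 0 0; rewrite scaleN1r oppr0 add0r scaleN1r addNr.
have dS n F : d (\sum_(i < n) F i) = \sum_(i < n) d (F i).
  apply: (big_morph d) => // p q.
  by have := dl 1 p q; rewrite !scale1r.
have dZ c p : d (c *: p) = c *: d p by have := dl c p 0; rewrite d0 !addr0.
split=> [c u v|u v]; apply: fpsP => n /=.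
  have := dl 1 (\sum_(i < n.+1) c i *: u (n - i)%N) (v n).
  rewrite !scale1r => ->; congr (_ + _).
  by rewrite dS; apply: eq_bigr => i _; rewrite dZ.
by rewrite dS -big_split; apply: eq_bigr => i _; rewrite dM.
Qed.

Lemma derivation_E : derivation (@derE R).
Proof.
apply: derivation_fps_map => [c p q|p q]; rewrite /dx /dy.
  by rewrite !mderivD !mderivZ -!mul_mpolyC; ring.
by rewrite !mderivM; ring.
Qed.

Lemma derivation_R : derivation (@derR R).
Proof.
apply: derivation_fps_map => [c p q|p q]; rewrite /dx /dy.
  by rewrite !mderivD !mderivZ -!mul_mpolyC; ring.
by rewrite !mderivM; ring.
Qed.

Lemma derE_const (p : Cxy R) :
  derE (fps_const p) = fps_const (xC R * dx p + yC R * dy p).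
Proof.
apply: fpsP => -[//|n] /=.
by rewrite /dx /dy !mderiv0 !mulr0 addr0.
Qed.

Lemma derR_const (p : Cxy R) :
  derR (fps_const p) = fps_const (yC R * dy p - xC R * dx p).
Proof.
apply: fpsP => -[//|n] /=.
by rewrite /dx /dy !mderiv0 !mulr0 subr0.
Qed.

Lemma mderiv_var (i j : 'I_2) : mderiv i ('X_j : Cxy R) = (i == j)%:R.
Proof.
rewrite mderivX mnm1E eq_sym; case: eqVneq => [->|_]; last by rewrite scale0r.
have -> : (U_(j) - U_(j) = 0 :> 'X_{1..2})%MM.
  by apply/mnmP => k; rewrite mnmBE subnn mnm0E.
by rewrite scale1r mpolyX0.
Qed.

Lemma derE_x : derE x_s = x_s.
Proof.
by rewrite derE_const /dx /dy /xC !mderiv_var mulr0 mulr1 addr0.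
Qed.

Lemma derE_y : derE y_s = y_s.
Proof.
by rewrite derE_const /dx /dy /yC !mderiv_var mulr0 mulr1 add0r.
Qed.

Lemma fps_constN (p : Cxy R) : fps_const (- p) = - fps_const p.
Proof. by apply: fpsP => -[|n] //=; rewrite oppr0. Qed.

Lemma derR_x : derR x_s = - x_s.
Proof.
rewrite derR_const /dx /dy /xC !mderiv_var mulr0 mulr1 sub0r.
exact: fps_constN.
Qed.

Lemma derR_y : derR y_s = y_s.
Proof.
by rewrite derR_const /dx /dy /yC !mderiv_var mulr0 mulr1 subr0.
Qed.

Lemma derE_t : derE (t_s R) = 2%:R * t_s R.
Proof. by rewrite t_sE (derM _ derivation_E) derE_x derE_y; ring. Qed.

Lemma derR_t : derR (t_s R) = 0.
Proof. by rewrite t_sE (derM _ derivation_R) derR_x derR_y; ring. Qed.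

(** The bracket is a derivation, and it kills [x] and [y] because both are eigenvectors of [E] and
    of [R]. *)
Lemma derER (f : As R) : derE (derR f) = derR (derE f).
Proof.
apply: subr0_eq; apply: (derivation_eq0 (der_bracket (@derE R) (@derR R))).
- exact: (derivation_bracket _ _ derivation_E derivation_R).
- rewrite /der_bracket derR_x derE_x derR_x (derN _ derivation_E) derE_x; ring.
- rewrite /der_bracket derR_y derE_y derR_y; ring.
Qed.

(** * The Saito basis for [t] *)

Lemma fps_const_mulI (p : Cxy R) u v :
  p != 0 -> fps_const p * u = fps_const p * v -> u = v.
Proof.
move=> p0 uv; apply: fpsP => n; apply: (mulfI p0).
by rewrite -!fps_constME uv.
Qed.

Lemma fps_const_X_dvd (i j : 'I_2) u v : i != j ->
  fps_const ('X_i : Cxy R) * u = fps_const 'X_j * v ->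
  exists w, u = fps_const 'X_j * w.
Proof.
move=> ij uv.
have /choice[w uw] n : exists r, u n = r * 'X_j.
  apply: (mpolyX_dvd _ _ i j _ (v n) ij).
  by rewrite mulrC -fps_constME uv fps_constME mulrC.
by exists (FPS w); apply: fpsP => n; rewrite fps_constME mulrC uw.
Qed.

Lemma Xord_neq0 (i : 'I_2) : ('X_i : Cxy R) != 0.
Proof.
apply/eqP => /(congr1 (fun p : Cxy R => p@_U_(i))).
by rewrite mcoeffX eqxx mcoeff0 => /eqP; rewrite oner_eq0.
Qed.

Lemma saito_basis_t : saito_basis (t_s R) (@derE R) (@derR R).
Proof.
split.
- by split; [exact: derivation_E | exists 2%:R; rewrite derE_t].
- by split; [exact: derivation_R | exists 0; rewrite derR_t mul0r].
move=> delta [d [r]]; rewrite t_sE (derM _ d) => dt.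
(* The condition on [t = x y] reads [y delta x + x delta y = r x y]; solving for either summand on
   the left shows the divisibility. *)
have [a da] : exists a, delta x_s = x_s * a.
  apply: (fps_const_X_dvd ord_max ord0 _ (r * y_s - delta y_s)) => //.
  change (y_s * delta x_s = x_s * (r * y_s - delta y_s)).
  by transitivity (r * (x_s * y_s) - x_s * delta y_s); [rewrite -dt|]; ring.
have [b db] : exists b, delta y_s = y_s * b.
  apply: (fps_const_X_dvd ord0 ord_max _ (r * x_s - delta x_s)) => //.
  change (x_s * delta y_s = y_s * (r * x_s - delta x_s)).
  by transitivity (r * (x_s * y_s) - delta x_s * y_s); [rewrite -dt|]; ring.
(* The constant one half. On [(x, y)] the fields [E] and [R] have eigenvalues [(1, 1)] and
   [(-1, 1)], so [delta] with eigenvalues [(a, b)] has coordinates [(a + b) / 2] and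
   [(b - a) / 2]. *)
pose h2 : As R := fps_const (2%:R^-1)%:MP.
have h22 : h2 + h2 = 1.
  apply: fpsP => -[|n] /=; last by rewrite addr0.
  have half : 2%:R^-1 + 2%:R^-1 = 1 :> R[i] by field.
  by rewrite -mpolyCD half.
exists (h2 * (a + b), h2 * (b - a)); split=> [f|[a' b'] ab] /=.
  (* The difference of the two sides is a derivation, so it suffices to test it on [x] and [y]. *)
  pose D f := - 1 * delta f +
    (h2 * (a + b) * derE f + h2 * (b - a) * derR f).
  have dD : derivation D.
    apply: derivation_comb => //; apply: derivation_comb.
      exact: derivation_E.
    exact: (derivation_scale _ _ derivation_R).
  apply/esym/subr0_eq; rewrite -[RHS](derivation_eq0 D dD _ _ f).
  - by rewrite /D; ring.
  - rewrite /D derE_x derR_x da.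
    by transitivity (x_s * a * (h2 + h2 - 1)); [ring | rewrite h22; ring].
  - rewrite /D derE_y derR_y db.
    by transitivity (y_s * b * (h2 + h2 - 1)); [ring | rewrite h22; ring].
(* For uniqueness, evaluate at [x] and [y] and cancel these nonzero factors: the eigenvalues
   determine the coordinates. *)
have /= ex := ab x_s; have /= ey := ab y_s.
have {ex da}-> : a = a' - b'.
  apply: (fps_const_mulI (xC R) _ _ (Xord_neq0 _)).
  by rewrite -/x_s -da ex derE_x derR_x; ring.
have {ey db}-> : b = a' + b'.
  apply: (fps_const_mulI (yC R) _ _ (Xord_neq0 _)).
  by rewrite -/y_s -db ey derE_y derR_y; ring.
congr pair.
  by transitivity ((h2 + h2) * a'); [ring | rewrite h22 mul1r].
by transitivity ((h2 + h2) * b'); [ring | rewrite h22 mul1r].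
Qed.

(** * The unit [h] and the Saito basis for [t h] *)

Definition s_s : As R := fpsX R[i] *: (1 : As R).

(** [h_s] is the geometric series in [s t]. *)
Lemma h_s_rec : h_s R = 1 + s_s * t_s R * h_s R.
Proof.
have -> : s_s * t_s R * h_s R = fpsX R[i] *: (t_s R * h_s R).
  by rewrite /s_s !fps_scaleE; ring.
apply: fpsP => n.
change (h_s R n = (1 : As R) n + (fpsX R[i] *: (t_s R * h_s R)) n).
rewrite fpsX_scaleE; case: n => [|n]; first by rewrite addr0.
by rewrite fps_constME add0r -exprS.
Qed.

Definition hV_s : As R := 1 - s_s * t_s R.

Lemma h_sV : h_s R * hV_s = 1.
Proof.
by transitivity (h_s R - s_s * t_s R * h_s R);
  [rewrite /hV_s; ring | rewrite {1}h_s_rec addrK].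
Qed.

(** By linearity [delta] kills [s_s]. Differentiating [h_s_rec] and collecting [delta h] on one side
    leaves the factor [hV_s], which multiplication by [h_s] removes. *)
Lemma der_h delta : derivation delta ->
  delta (h_s R) = s_s * h_s R ^+ 2 * delta (t_s R).
Proof.
move=> d.
have ds : delta s_s = 0 by rewrite (derZ _ d) (der1 _ d) scaler0.
have dh : delta (h_s R) * hV_s = s_s * h_s R * delta (t_s R).
  transitivity (delta (h_s R) - s_s * t_s R * delta (h_s R)).
    by rewrite /hV_s; ring.
  rewrite {1}h_s_rec (derD _ d) (der1 _ d) !(derM _ d) ds; ring.
transitivity (delta (h_s R) * hV_s * h_s R); last by rewrite dh; ring.
by rewrite -mulrA [hV_s * _]mulrC h_sV mulr1.
Qed.

(* Since [h = 1 / (1 - s t)], the map [t |-> t h] has derivative [h ^ 2]. *)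
Lemma der_th delta : derivation delta ->
  delta (t_s R * h_s R) = h_s R ^+ 2 * delta (t_s R).
Proof.
move=> d; rewrite (derM _ d) (der_h _ d).
transitivity ((1 + s_s * t_s R * h_s R) * h_s R * delta (t_s R)); first by ring.
by rewrite -h_s_rec; ring.
Qed.

(** By [der_th], passing from [t] to [t h] multiplies [delta t] by the unit [h ^ 2] and the
    generator of the ideal by the unit [h]. *)
Lemma log_der_th delta :
  log_der (t_s R * h_s R) delta <-> log_der (t_s R) delta.
Proof.
split=> -[d [r dr]]; split=> //; last first.
  by exists (r * h_s R); rewrite (der_th _ d) dr; ring.
exists (r * hV_s).
transitivity (hV_s ^+ 2 * delta (t_s R * h_s R)).
  rewrite (der_th _ d) mulrA -exprMn [hV_s * _]mulrC h_sV expr1n; ring.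
rewrite dr.
transitivity (r * hV_s * t_s R * (h_s R * hV_s)); first by ring.
by rewrite h_sV mulr1.
Qed.

(** The logarithmic fields are those of [t]; rescaling the first basis field by the unit [h] divides
    the first coordinate by [h]. *)
Lemma saito_basis_th :
  saito_basis (t_s R * h_s R) (fun f => h_s R * derE f) (@derR R).
Proof.
have [_ _ tP] := saito_basis_t.
have hK u : u = h_s R * (hV_s * u) by rewrite mulrA h_sV mul1r.
split.
- apply/log_der_th; split; first exact: (derivation_scale _ _ derivation_E).
  by exists (2%:R * h_s R); rewrite derE_t; ring.
- apply/log_der_th; split; first exact: derivation_R.
  by exists 0; rewrite derR_t mul0r.
move=> delta /log_der_th/tP[[a b] [/= dE uniq_ab]].
exists (hV_s * a, b); split=> [f|[a' b'] /= dE'] /=.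
  by rewrite dE [in LHS](hK a); ring.
have [-> ->] : (a, b) = (a' * h_s R, b').
  by apply: uniq_ab => f /=; rewrite dE'; ring.
by congr pair; rewrite [RHS]hK; ring.
Qed.

Lemma derR_h : derR (h_s R) = 0.
Proof. by rewrite (der_h _ derivation_R) derR_t mulr0. Qed.

(* The bracket term of the Cartan differential vanishes for commuting fields. *)
Lemma log_de_Rham_of_commuting g delta1 delta2 d0 d1 :
  saito_basis g delta1 delta2 ->
  (forall f, delta1 (delta2 f) = delta2 (delta1 f)) ->
  (forall f, d0 f = (delta1 f, delta2 f)) ->
  (forall ab, d1 ab = delta1 ab.2 - delta2 ab.1) ->
  @log_de_Rham_in_basis R g delta1 delta2 d0 d1.
Proof.
move=> sb comm12 d0E d1E; split=> // w w1; rewrite d1E /log_d1 /=.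
have -> : der_bracket delta1 delta2 = (fun=> 0).
  by apply/funext => f; rewrite /der_bracket comm12 subrr.
(* Linearity of [w] holds only on logarithmic fields, so the zero field must be shown to be one;
   then [w] at zero equals its own double and vanishes. *)
have log0 : log_der g (fun=> 0).
  by split; [exact: derivation0 | exists 0; rewrite mul0r].
have := w1 1 _ _ log0 log0; cbv beta; rewrite !mul1r addr0.
by rewrite -[X in X = _]addr0 => /addrI <-; rewrite subr0.
Qed.

End Derivations.

(** * The two complexes and the isomorphism between them *)

Theorem proposition5p27 (R : realType) :
  [/\ log_de_Rham_in_basis (t_s R) (@derE R) (@derR R)
        (@eps0_1 R) (@eps0_2 R),
      log_de_Rham_in_basis (t_s R * h_s R)
        (fun f => h_s R * derE f) (@derR R) (@epss_1 R) (@epss_2 R),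
      @is_complex (Cs R) (As R) (As R * As R)%type (As R)
        (@eps0_1 R) (@eps0_2 R),
      @is_complex (Cs R) (As R) (As R * As R)%type (As R)
        (@epss_1 R) (@epss_2 R) &
      @cochain_iso (Cs R)
        (As R) (As R * As R)%type (As R) (As R) (As R * As R)%type (As R)
        (@eps0_1 R) (@eps0_2 R) (@epss_1 R) (@epss_2 R)
        (@Psi0 R) (@Psi1 R) (@Psi2 R)].
Proof.
have dE := derivation_E R; have dR := derivation_R R.
have dhE := derivation_scale R (h_s R) _ dE.
(* This yields both the commutation of [h E] with [R] and the compatibility of [Psi1] with
   [Psi2]. *)
have Rh u : derR (h_s R * u) = h_s R * derR u.
  by rewrite (derM _ _ dR) derR_h mul0r add0r.
have hZ (c : Cs R) u : h_s R * (c *: u) = c *: (h_s R * u).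
  by rewrite !fps_scaleE; ring.
have hb : bijective (fun u : As R => h_s R * u).
  by exists (fun u => hV_s R * u) => u; rewrite mulrA ?[hV_s R * _]mulrC h_sV mul1r.
split.
- apply: log_de_Rham_of_commuting => //; first exact: saito_basis_t.
  exact: derER.
- apply: log_de_Rham_of_commuting => //; first exact: saito_basis_th.
  by move=> f; rewrite Rh derER.
- split=> [c u v|c [a b] [a' b']|f].
  + by rewrite /eps0_1 (proj1 dE) (proj1 dR).
  + by rewrite /eps0_2 /= (proj1 dE) (proj1 dR) scalerBr; ring.
  + by rewrite /eps0_2 /= derER subrr.
- split=> [c u v|c [a b] [a' b']|f].
  + by rewrite /epss_1 (proj1 dhE) (proj1 dR).
  + by rewrite /epss_2 /= (proj1 dhE) (proj1 dR) scalerBr; ring.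
  + by rewrite /epss_2 /= Rh derER subrr.
split; last first.
  split=> //; first by exists id.
  have [g gK Kg] := hb.
  by exists (fun ab => (g ab.1, ab.2)) => -[a b]; rewrite /Psi1 /= ?gK ?Kg.
(* The square from degree 0 to degree 1 commutes by definition; the other one is
   [h E b - R (h a) = h (E b - R a)]. *)
split=> // [c [a b] [a' b']|c u v|[a b]].
- by rewrite /Psi1 /= mulrDr hZ.
- by rewrite /Psi2 mulrDr hZ.
- by rewrite /Psi2 /eps0_2 /epss_2 /Psi1 /= Rh mulrBr.
Qed.
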